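(* Let $h$ be any integer such that $0\le h\le 2$, and let $i,k\in\{0,1\}$. Let $I_{i,k}(X,h)$ be the number of solutions of the equation $n-3m=h$ in positive integers $m,n$ with $m\le X$, $m\in\mathbb{N}_i$, $n\in\mathbb{N}_k$. Then, as $X\to\infty$, $$I_{i,k}(X,h)=\frac{X}{4}+O(X^\lambda),\qquad \lambda=\frac{\ln 3}{\ln 4}=0.7924818\ldots$$
   Context: For a positive integer $n$ write its binary expansion $n=\sum_{k=0}^\infty \varepsilon_k 2^k$ with $\varepsilon_k\in\{0,1\}$. The set of positive integers is split into two disjoint classes: $\mathbb{N}_0$ is the set of positive integers $n$ with $\sum_{k=0}^\infty\varepsilon_k\equiv 0\pmod 2$, and $\mathbb{N}_1$ is the set of positive integers $n$ with $\sum_{k=0}^\infty\varepsilon_k\equiv 1\pmod 2$. *)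

(* Defs.v *)
From HB Require Import structures.
From mathcomp Require Import all_boot all_order all_algebra finmap.
From mathcomp Require Import all_classical all_reals all_analysis.

Set Implicit Arguments.
Unset Strict Implicit.
Unset Printing Implicit Defensive.

Import Order.TTheory GRing.Theory Num.Theory.
Import numFieldNormedType.Exports.

Local Open Scope classical_set_scope.
Local Open Scope nat_scope.

Definition bin_digit (n k : nat) : nat := (n %/ 2 ^ k) %% 2.

(* Since n < 2 ^ n, the digits of index k >= n vanish, so that the infinite
   sum of digits is the sum over k < n. *)
Definition bin_digit_sum (n : nat) : nat := \sum_(k < n) bin_digit n k.

Lemma bin_expansion_modn (n j : nat) :
  n %% 2 ^ j = \sum_(k < j) bin_digit n k * 2 ^ k.
Proof.
elim: j => [|j IHj]; first by rewrite big_ord0 expn0 modn1.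
rewrite big_ord_recr /= -IHj /bin_digit.
have j0 : 0 < 2 ^ j by rewrite expn_gt0.
rewrite {1}(divn_eq n (2 ^ j)) {1}(divn_eq (n %/ 2 ^ j) 2).
rewrite mulnDl -mulnA -expnS -addnA modnMDl modn_small 1?addnC //.
have d2 : (n %/ 2 ^ j) %% 2 <= 1 by rewrite -ltnS ltn_pmod.
rewrite expnS mul2n -addnn.
apply: (@leq_ltn_trans (2 ^ j + n %% 2 ^ j)); last by rewrite ltn_add2l ltn_pmod.
by rewrite addnC leq_add2r -[leqRHS]mul1n leq_mul2r d2 orbT.
Qed.

Lemma bin_expansion (n : nat) : n = \sum_(k < n) bin_digit n k * 2 ^ k.
Proof. by rewrite -bin_expansion_modn modn_small // ltn_expl. Qed.

Lemma bin_digit_eq0 (n k : nat) : n <= k -> bin_digit n k = 0.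
Proof.
by move=> nk; rewrite /bin_digit divn_small // (leq_ltn_trans nk) // ltn_expl.
Qed.

Definition parity_class (i : 'I_2) : set nat :=
  [set n | 0 < n /\ bin_digit_sum n = i %[mod 2]].

Local Open Scope ring_scope.

(* Lets the Landau notations be used with the filter +oo. *)
Canonical pinfty_filter_on (R : numFieldType) :=
  FilterType (pinfty_nbhs R) (@proper_pinfty_nbhs R).

Definition solutions (R : realType) (i k : 'I_2) (X : R) (h : int) :
    set (nat * nat) :=
  [set mn | [/\ mn.2%:Z - 3 * mn.1%:Z = h, mn.1%:R <= X,
             parity_class i mn.1 & parity_class k mn.2]].

Lemma finite_solutions (R : realType) (i k : 'I_2) (X : R) (h : int) :
  finite_set (solutions i k X h).
Proof.
pose f (m : nat) : nat * nat := (m, absz (h + 3 * m%:Z)).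
apply: (@sub_finite_set _ _ (f @` `I_(Num.truncn X).+1)); last first.
  exact/finite_image/finite_II.
move=> [m n] [/= mnh mX _ _]; exists m => /=.
  rewrite ltnS.
  have X0 : 0 <= X by exact: le_trans mX.
  by rewrite truncn_ge_nat.
by rewrite /f -mnh subrK absz_nat.
Qed.

(* [fset_set] has its intended meaning here by [finite_solutions]. *)
Definition num_solutions (R : realType) (i k : 'I_2) (X : R) (h : int) : nat :=
  #|` fset_set (solutions i k X h)|.

(* Main.v *)
(* With [e n = (-1) ^ (binary digit sum of n)], four times the indicator of
   "m in N_i and 3m+h in N_k" is
   [(1 + (-1)^i e(m)) (1 + (-1)^k e(3m+h))], so everything reduces to bounding
   the sums over [m < N] of [e(m)], [e(3m+h)] and [e(m) e(3m+h)]. The first is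
   bounded. Splitting [m] modulo 4 expresses the other two at [4N], for
   [h = 0, 1, 2] jointly, linearly through their values at [N], with growth
   factor at most 3. Hence they are [O(3^j)] for [N < 4^j], that is,
   [O(N^(ln 3 / ln 4))]. *)

Require Import Defs.
From HB Require Import structures.
From mathcomp Require Import all_boot all_order all_algebra finmap.
From mathcomp Require Import all_classical all_reals all_analysis.
From mathcomp Require Import zify ring lra.

Import Order.TTheory GRing.Theory Num.Theory.
Import numFieldNormedType.Exports.

Local Open Scope classical_set_scope.
Local Open Scope ring_scope.

(** * Thue-Morse signs and appended digits in base 2 and 4 *)

Lemma bin_digit_sum_double (n b : nat) :
  (b < 2)%N -> bin_digit_sum (2 * n + b) = (bin_digit_sum n + b)%N.
Proof.
move=> b2; rewrite {1}/bin_digit_sum.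
(* The range in [bin_digit_sum n] depends on [n]; digits of index at least [n] vanish, so it may be
   lengthened. *)
have widen N : (n <= N)%N -> (\sum_(k < N) bin_digit n k = bin_digit_sum n)%N.
  move=> nN; rewrite -(subnKC nN) big_split_ord /= [X in (_ + X)%N]big1 ?addn0 //.
  by move=> k _; rewrite bin_digit_eq0 // leq_addr.
have digitS k : bin_digit (2 * n + b) k.+1 = bin_digit n k.
  by rewrite /bin_digit expnS divnMA (mulnC 2) divnMDl // (divn_small b2) addn0.
case E: (2 * n + b)%N => [|N]; first by rewrite -(widen 0) ?big_ord0; lia.
rewrite big_ord_recl; under eq_bigr do rewrite /= -E digitS.
rewrite widen; last by lia.
rewrite /= -E {1}/bin_digit expn0 divn1; lia.
Qed.

Definition thue_morse (n : nat) : int := (-1) ^+ bin_digit_sum n.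

Local Notation tm := thue_morse.

Lemma thue_morse_double (n b : nat) :
  (b < 2)%N -> tm (2 * n + b) = (-1) ^+ b * tm n.
Proof. by move=> b2; rewrite /tm bin_digit_sum_double // exprD mulrC. Qed.

Lemma thue_morse0 : tm 0 = 1.
Proof. by rewrite /tm /bin_digit_sum big_ord0. Qed.

Lemma thue_morse1 : tm 1 = -1.
Proof. by have := @thue_morse_double 0 1 isT; rewrite thue_morse0. Qed.

Lemma thue_morse2 : tm 2 = -1.
Proof. by have := @thue_morse_double 1 0 isT; rewrite thue_morse1. Qed.

Lemma thue_morse3 : tm 3 = 1.
Proof. by have := @thue_morse_double 1 1 isT; rewrite thue_morse1. Qed.

Definition thue_morse_small :=
  (thue_morse0, thue_morse1, thue_morse2, thue_morse3).

Lemma thue_morse_quad (n c : nat) : (c < 4)%N -> tm (4 * n + c) = tm c * tm n.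
Proof.
move=> c4; have c2 : (c %/ 2 < 2)%N by lia.
have m2 : (c %% 2 < 2)%N by lia.
have -> : (4 * n + c = 2 * (2 * n + c %/ 2) + c %% 2)%N by lia.
have {3}-> : (c = 2 * (2 * 0 + c %/ 2) + c %% 2)%N by lia.
by rewrite !thue_morse_double // thue_morse0 mulr1 mulrA.
Qed.

(** Here [(3 * b + h) %/ 4] is the carry. For [b < 4] and [h < 3] it is at most 2, so the shifts 0,
    1, 2 are closed under splitting modulo 4. *)
Lemma thue_morse_mul3 (n b h : nat) :
  tm (3 * (4 * n + b) + h) =
    tm ((3 * b + h) %% 4) * tm (3 * n + (3 * b + h) %/ 4).
Proof. by rewrite -thue_morse_quad ?ltn_pmod //; congr tm; lia. Qed.

Ltac compute_quotients :=
  repeat match goal with |- context [(?a %/ 4)%N] =>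
    let q := eval compute in (a %/ 4)%N in change (a %/ 4)%N with q
  end.

Lemma normr_thue_morse (n : nat) : `|tm n| = 1.
Proof. by rewrite normrX normrN1 expr1n. Qed.

(** * Sums cut into blocks *)

Lemma sum_ord_block4 (F : nat -> int) (N : nat) :
  \sum_(m < (4 * N)%N) F m =
    \sum_(m < N) (F (4 * m + 0)%N + F (4 * m + 1)%N + F (4 * m + 2)%N +
                  F (4 * m + 3)%N).
Proof.
elim: N => [|N IHN]; first by rewrite !big_ord0.
rewrite [RHS]big_ord_recr -IHN mulnS [(4 + _)%N]addnC !addnS !addn0.
by rewrite !big_ord_recr /= !addrA.
Qed.

Lemma sum_ord_block3 (F : nat -> int) (N : nat) :
  \sum_(m < (3 * N)%N) F m =
    \sum_(m < N) (F (3 * m + 0)%N + F (3 * m + 1)%N + F (3 * m + 2)%N).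
Proof.
elim: N => [|N IHN]; first by rewrite !big_ord0.
rewrite [RHS]big_ord_recr -IHN mulnS [(3 + _)%N]addnC !addnS !addn0.
by rewrite !big_ord_recr /= !addrA.
Qed.

Lemma sum_ord_tail (F : nat -> int) (N r : nat) : (forall m, `|F m| <= 1) ->
  `|\sum_(m < (N + r)%N) F m - \sum_(m < N) F m| <= r%:Z.
Proof.
move=> F1; rewrite big_split_ord /= addrAC subrr add0r.
apply: (le_trans (ler_norm_sum _ _ _)).
by apply: (le_trans (ler_sum _ (fun i _ => F1 _))); rewrite sumr_const card_ord natz.
Qed.

(** The signs at [2 * q] and [2 * q + 1] cancel, leaving at most one term. *)
Lemma normr_sum_thue_morse (N : nat) : `|\sum_(m < N) tm m| <= 1.
Proof.
have dbl q : \sum_(m < (2 * q)%N) tm m = 0.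
  elim: q => [|q IHq]; first by rewrite big_ord0.
  rewrite mulnS addnC !addnS addn0 !big_ord_recr /= IHq add0r.
  have := thue_morse_double q 0 isT; have := thue_morse_double q 1 isT.
  by rewrite addn0 addn1 => -> ->; lia.
have := @sum_ord_tail tm (2 * (N %/ 2)) (N %% 2) _.
rewrite dbl subr0 (_ : 2 * _ + _ = N)%N; last by lia.
move=> bnd; apply: le_trans (bnd _) _; last by lia.
by move=> m; rewrite normr_thue_morse.
Qed.

(** * Recurrences from [N] to [4 * N] and the resulting bounds *)

Definition sum3 (h N : nat) : int := \sum_(m < N) tm (3 * m + h).

Definition corr3 (h N : nat) : int := \sum_(m < N) tm m * tm (3 * m + h).

(* Going from [N] to [4 N] multiplies the vector of the [sum3 h] by [3 I - J],
   with [J] the all-ones matrix, and [J] only contributes the bounded sum of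
   [thue_morse] over an initial segment. *)
Lemma sum3_quad (h N : nat) : (h < 3)%N ->
  sum3 h (4 * N) = 3 * sum3 h N - \sum_(m < (3 * N)%N) tm m.
Proof.
rewrite /sum3 (sum_ord_block4 (fun m => tm (3 * m + h))) sum_ord_block3.
rewrite mulr_sumr -sumrB => h3; apply: eq_bigr => m _.
rewrite !thue_morse_mul3.
case: h h3 => [|[|[|//]]] _; rewrite !thue_morse_small; compute_quotients; ring.
Qed.

(** Each residue [b] contributes [corr3] at its carry, with sign [tm b * tm ((3 * b + h) %% 4)]. *)
Lemma corr3_quad (N : nat) :
  [/\ corr3 0 (4 * N) = corr3 1 N - corr3 2 N,
      corr3 1 (4 * N) = - corr3 0 N - 2 * corr3 1 N - corr3 2 N &
      corr3 2 (4 * N) = corr3 1 N - corr3 0 N].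
Proof.
split; rewrite /corr3 (sum_ord_block4 (fun m => tm m * tm (3 * m + _)));
  rewrite ?mulr_sumr -?sumrN -?sumrB -?big_split; apply: eq_bigr => m _ /=;
  rewrite !thue_morse_mul3 !thue_morse_quad // !thue_morse_small;
  compute_quotients; ring.
Qed.

(** [P N K] is meant as a bound by [K] at [N]. The 4 covers at most three leftover terms and the
    bounded sum of signs in [sum3_quad]; iterating [3 * K + 4] from 0 gives [2 * 3 ^+ j - 2]. *)
Lemma quad_induction (P : nat -> int -> Prop) : P 0%N 0 ->
  (forall (N r : nat) K, (r < 4)%N -> P N K -> P (4 * N + r)%N (3 * K + 4)) ->
  forall j N, (N < 4 ^ j)%N -> P N (2 * 3 ^+ j - 2).
Proof.
move=> P0 Pquad; elim=> [|j IHj] N.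
  by rewrite expn0 ltnS leqn0 => /eqP ->; rewrite expr0.
rewrite expnS => Nj; have r4 : (N %% 4 < 4)%N by rewrite ltn_pmod.
have q4 : (N %/ 4 < 4 ^ j)%N by rewrite ltn_divLR // mulnC.
have := Pquad _ _ _ r4 (IHj _ q4); rewrite mulnC -divn_eq exprS.
by congr P; ring.
Qed.

Lemma sum3_tail (h N r : nat) : `|sum3 h (N + r) - sum3 h N| <= r%:Z.
Proof.
apply: (@sum_ord_tail (fun m => tm (3 * m + h))) => m.
by rewrite normr_thue_morse.
Qed.

Lemma corr3_tail (h N r : nat) : `|corr3 h (N + r) - corr3 h N| <= r%:Z.
Proof.
apply: (@sum_ord_tail (fun m => tm m * tm (3 * m + h))) => m.
by rewrite normrM !normr_thue_morse.
Qed.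

Lemma sum3_bound (h j N : nat) : (h < 3)%N -> (N < 4 ^ j)%N ->
  `|sum3 h N| <= 2 * 3 ^+ j - 2.
Proof.
move=> h3; apply: (quad_induction (fun N K => `|sum3 h N| <= K)).
  by rewrite /sum3 big_ord0 normr0.
move=> {}N r K r4 NK.
have := sum3_tail h (4 * N) r; have := normr_sum_thue_morse (3 * N).
by rewrite sum3_quad //; lia.
Qed.

(* The matrix of [corr3_quad] has norm at most 3 for the sup norm with weights
   [1, 1/2, 1], although its row sums reach 4. *)
Lemma corr3_bound (h j N : nat) : (h < 3)%N -> (N < 4 ^ j)%N ->
  `|corr3 h N| <= 2 * (2 * 3 ^+ j - 2).
Proof.
move=> h3 Nj.
have [||b0 b1 b2] := quad_induction (fun N K =>
  [/\ `|corr3 0 N| <= K, `|corr3 1 N| <= 2 * K & `|corr3 2 N| <= K]) _ _ j N Nj.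
- by rewrite /corr3 !big_ord0 normr0.
- move=> {Nj}N r K r4 [k0 k1 k2].
  have [] := corr3_quad N.
  have := corr3_tail 0 (4 * N) r; have := corr3_tail 1 (4 * N) r.
  have := corr3_tail 2 (4 * N) r.
  by move=> ? ? ? ? ? ?; split; lia.
by case: h h3 => [|[|[|//]]] _; lia.
Qed.

(** * Counting solutions by sign sums *)

Definition in_classes (i k : 'I_2) (h m : nat) : bool :=
  (bin_digit_sum m == i %[mod 2]) && (bin_digit_sum (3 * m + h) == k %[mod 2]).

(** A solution is determined by [m], since [n = 3 * m + h]. *)
Lemma num_solutionsE (R : realType) (i k : 'I_2) (X : R) (h : nat) : 0 <= X ->
  num_solutions i k X h%:Z =
    (\sum_(1 <= m < (Num.trunc X).+1) in_classes i k h m)%N.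
Proof.
move=> X0; pose s := [seq m <- iota 1 (Num.trunc X) | in_classes i k h m].
have inj : injective (fun m => (m, 3 * m + h)%N) by move=> ? ? [].
rewrite /num_solutions.
have /perm_size -> : perm_eq (fset_set (solutions i k X h%:Z))
    [seq (m, 3 * m + h)%N | m <- s].
  apply: uniq_perm; rewrite ?fset_uniq ?map_inj_uniq ?filter_uniq ?iota_uniq //.
  move=> [m n]; rewrite in_fset_set; last exact: finite_solutions.
  apply/idP/mapP.
    rewrite inE => -[/= e mX [m0 mi] [n0 nk]].
    have en : n = (3 * m + h)%N by lia.
    exists m; last by rewrite en.
    rewrite mem_filter mem_iota /in_classes -en mi nk !eqxx /= add1n ltnS.
    by rewrite m0 truncn_ge_nat.
  move=> [m']; rewrite mem_filter mem_iota => /andP[/andP[/eqP mi /eqP nk]].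
  rewrite add1n ltnS truncn_ge_nat // => /andP[m0 mX] [-> ->].
  by rewrite inE; split => //=; [lia | split; [lia|]].
rewrite size_map size_filter -sum1_count big_mkcond /index_iota subn1 /=.
by apply: eq_bigr => m _; case: in_classes.
Qed.

Lemma in_classesE (i k : 'I_2) (h m : nat) :
  (4 * in_classes i k h m)%N%:Z =
    1 + (-1) ^+ i * tm m + (-1) ^+ k * tm (3 * m + h)
      + (-1) ^+ (i + k) * (tm m * tm (3 * m + h)).
Proof.
have mod2 a b : (a == b %[mod 2]) = (odd a == odd b).
  by rewrite !modn2; case: (odd a); case: (odd b).
rewrite /in_classes /tm exprD !mod2 -!(signr_odd _ (bin_digit_sum _)).
rewrite -(signr_odd _ i) -(signr_odd _ k).
by case: (odd i); case: (odd k); do 2 case: (odd (bin_digit_sum _)).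
Qed.

Lemma num_solutions_bound (R : realType) (i k : 'I_2) (X : R) (h j : nat) :
  (h < 3)%N -> 0 <= X -> ((Num.trunc X).+1 < 4 ^ j)%N ->
  `|(4 * num_solutions i k X h%:Z)%N%:Z - (Num.trunc X)%:Z| <= 6 * 3 ^+ j.
Proof.
move=> h3 X0 Mj; rewrite num_solutionsE //; move: (Num.trunc X) Mj => M Mj.
(* Solutions start at [m = 1], whereas the bounded sums include [m = 0]. *)
have sumS F : \sum_(1 <= m < M.+1) F m = \sum_(m < M.+1) F m - F 0%N :> int.
  by rewrite -(big_mkord xpredT F) big_ltn // addrC addKr.
rewrite big_distrr /= -natz natr_sum.
under eq_bigr do rewrite natz in_classesE.
rewrite !big_split /= -!mulr_sumr !sumS -/(sum3 h M.+1) -/(corr3 h M.+1).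
rewrite sumr_const card_ord natz muln0 add0n thue_morse0 mul1r.
have := sum3_bound h j M.+1 h3 Mj; have := corr3_bound h j M.+1 h3 Mj.
have := normr_sum_thue_morse M.+1; have := normr_thue_morse h.
(* With [K = 3 ^+ j], the 6 is 4 from [corr3] plus 2 from [sum3]; their negative constants absorb
   the remaining bounded terms. *)
have tri (u v : bool) (K a b c d : int) : `|d| = 1 -> `|a| <= 1 ->
    `|b| <= 2 * (2 * K - 2) -> `|c| <= 2 * K - 2 ->
    `|M.+1%:Z - 1 + (-1) ^+ u * (a - 1) + (-1) ^+ v * (c - d) +
      (-1) ^+ u * (-1) ^+ v * (b - d) - M%:Z| <= 6 * K.
  by case: u; case: v; rewrite ?expr1 ?expr0; lia.
by rewrite exprD -(signr_odd _ i) -(signr_odd _ k); exact: tri.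
Qed.

(** * The exponent and the asymptotic formula *)

Lemma powR_log_base (R : realType) (n : nat) :
  (4 ^ n)%:R `^ (ln 3 / ln 4) = 3 ^+ n :> R.
Proof.
have ln4 : ln 4 != 0 :> R by rewrite gt_eqF // ln_gt0 // ltr1n.
rewrite natrX -powR_mulrn // powRAC powR_mulrn ?powR_ge0 //; congr (_ ^+ _).
by rewrite /powR pnatr_eq0 /= divfK // lnK // posrE.
Qed.

Theorem theorem1 (R : realType) (h : int) (hh : 0 <= h <= 2) (i k : 'I_2) :
  (fun X : R => (num_solutions i k X h)%:R : R) =
    (fun X : R => X / 4) +O_ +oo (fun X : R => X `^ (ln 3 / ln 4)).
Proof.
have [{hh}h -> h3] : exists2 n : nat, h = n%:Z & (n < 3)%N.
  by exists `|h|%N; lia.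
apply/eqaddOP; near=> c; near=> X.
have X1 : 1 <= X by near: X; exact: nbhs_pinfty_ge.
(* The final error is at most [(6 * 9 * 3 ^+ t + 1) / 4], where the 1 comes from truncating [X];
   this is below 14 times the power of [X]. *)
have c14 : 14 <= c by near: c; exact: nbhs_pinfty_ge.
have X0 : 0 <= X by lra.
rewrite [X in _ <= _ * X]ger0_norm ?powR_ge0 //=.
set lam := ln 3 / ln 4.
have lam0 : 0 <= lam by rewrite divr_ge0 // ln_ge0 // ler1n.
have /andP[MX] := truncn_itv X0; rewrite -natr1 => XM.
have M0 : (0 < Num.trunc X)%N by rewrite truncn_ge_nat.
have /= /andP[tM Mt] := trunc_log_bounds (isT : 1 < 4)%N M0.
set t := trunc_log 4 (Num.trunc X) in tM Mt.
(* The truncation is below [4 ^ t.+1]; its successor may reach that power, hence [t.+2]. *)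
have Mt2 : ((Num.trunc X).+1 < 4 ^ t.+2)%N.
  by apply: (leq_ltn_trans Mt); rewrite ltn_exp2l.
have := num_solutions_bound R i k X h t.+2 h3 X0 Mt2.
rewrite -(ler_int R) intr_norm rmorphB rmorphM rmorphXn /=.
have tX : 3 ^+ t <= X `^ lam.
  rewrite -powR_log_base ge0_ler_powR ?nnegrE ?ler0n //.
  by apply: le_trans MX; rewrite ler_nat.
have lam1 : 1 <= X `^ lam.
  by have : 1 `^ lam <= X `^ lam; [rewrite ge0_ler_powR ?nnegrE | rewrite powR1].
rewrite -!pmulrn !exprS natrM.
set n := (num_solutions i k X h)%:R; set M := (Num.trunc X)%:R in MX XM *.
move=> bnd; have {}bnd : `|4 * n - M| <= 6 * (3 * (3 * 3 ^+ t)) by [].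
apply: (@le_trans _ _ (14 * X `^ lam)); last by rewrite ler_wpM2r ?powR_ge0.
rewrite -[X in `|X| <= _]/(n - X / 4).
move: bnd; rewrite !ler_norml => /andP[lo up].
by apply/andP; split; lra.
Unshelve. all: by end_near.
Qed.
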